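(* Let $\lambda>0$ and let $\mathcal{F}$ be a collection of $\lambda$-Lipschitz maps between metric spaces. The following are equivalent: (i) $\mathcal{F}$ factors the Hamming cubes. (ii) $\mathcal{F}$ crudely factors the Hamming cubes. (iii) $\limsup_n a_n(\mathcal{F})>0$. (iv) For each $1<p<\infty$, $\limsup_n b_{p,n}(\mathcal{F})>0$. (v) For some $1<p<\infty$, $\limsup_n b_{p,n}(\mathcal{F})>0$.
   Context: Convention $\frac{0}{0}=0$. For a map $g:(U,d_U)\to(V,d_V)$, $\mathrm{Lip}(g)=\sup_{x,y\in U} d_V(g(x),g(y))/d_U(x,y)$. The Hamming cube $2^n=\{\pm1\}^n$ carries the normalized graph metric $\partial(\varepsilon,\delta)=\frac1n|\{i:\varepsilon(i)\neq\delta(i)\}|$ and the uniform probability measure $\mathbb{P}$ (expectation $\mathbb{E}$ over $\varepsilon\in 2^n$). $d_i$ flips the $i$-th coordinate. For $F:X\to Y$ and $f:2^n\to X$, set $\varrho^f_X(\varepsilon,\delta)=d_X(f(\varepsilon),f(\delta))$ and $\varrho^f_Y(\varepsilon,\delta)=d_Y(F\circ f(\varepsilon),F\circ f(\delta))$. $a_n(\mathcal{F})$ is the infimum of those $a>0$ such that for each $F:X\to Y$ in $\mathcal{F}$ and each $f:2^n\to X$, $\mathbb{E}\varrho^f_Y(\varepsilon,-\varepsilon)\le a\,\mathrm{Lip}(f)$. For $1<p<\infty$, $b_{p,n}(\mathcal{F})$ is the infimum of those $b>0$ such that for each $F:X\to Y$ in $\mathcal{F}$ and each $f:2^n\to X$,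 $\mathbb{E}\varrho^f_Y(\varepsilon,-\varepsilon)^p\le b^p n^{p-1}\sum_{i=1}^n \mathbb{E}\varrho^f_X(\varepsilon,d_i\varepsilon)^p$. $\mathcal{F}$ crudely factors the Hamming cubes if there exist $c,D>0$ such that for each $n$ there exist $F:X\to Y$ in $\mathcal{F}$, $f:2^n\to X$ and $a,b>0$ with $b\ge ac$ and, for all $\varepsilon,\delta\in 2^n$, $\frac aD\partial(\varepsilon,\delta)\le d_X(f(\varepsilon),f(\delta))\le aD\partial(\varepsilon,\delta)$ and $\frac bD\partial(\varepsilon,\delta)\le d_Y(F\circ f(\varepsilon),F\circ f(\delta))\le bD\partial(\varepsilon,\delta)$. $\mathcal{F}$ factors the Hamming cubes if there exists $c>0$ such that for each $D>1$ and each $n$ such $F,f,a,b$ exist. *)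

(* Defs.v *)
From HB Require Import structures.
From mathcomp Require Import all_boot all_order all_algebra.
From mathcomp Require Import all_classical all_reals all_analysis.
Set Implicit Arguments. Unset Strict Implicit. Unset Printing Implicit Defensive.
Import Order.TTheory GRing.Theory Num.Theory.
Local Open Scope ring_scope.
Local Open Scope classical_set_scope.

Record metricSpace (R : realType) := MetricSpace {
  mcarrier :> Type;
  mdist : mcarrier -> mcarrier -> R;
  mdist0 : forall x y, mdist x y = 0 <-> x = y;
  mdistC : forall x y, mdist x y = mdist y x;
  mdist_tri : forall x y z, mdist x z <= mdist x y + mdist y z }.

Arguments mdist {R m} _ _.

Record metricMap (R : realType) := MetricMap {
  msrc : metricSpace R;
  mtgt : metricSpace R;
  mfun : msrc -> mtgt }.
Arguments mfun {R} m _.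

(* The Hamming cube 2^n = {+-1}^n, coded as boolean vectors (true = +1). *)
Definition cube (n : nat) := {ffun 'I_n -> bool}.

Definition cneg n (e : cube n) : cube n := [ffun i => ~~ e i].
Definition cflip n (i : 'I_n) (e : cube n) : cube n :=
  [ffun j => if j == i then ~~ e j else e j].

(* normalized Hamming metric (0/0 = 0 for n = 0) *)
Definition hamming (R : realType) n (e d : cube n) : R :=
  #|[set i | e i != d i]|%:R / n%:R.

Definition cubeE (R : realType) n (g : cube n -> R) : R :=
  (\sum_(e : cube n) g e) / (#|{: cube n}|)%:R.

(* Lip(g) for g : 2^n -> X, with the convention 0/0 = 0 (the sup of a
   finite nonempty set of nonnegative reals, computed as a finite max). *)
Definition lipCube (R : realType) n (X : metricSpace R) (g : cube n -> X) : R :=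
  \big[Num.max/0]_(e : cube n) \big[Num.max/0]_(d : cube n)
     (mdist (g e) (g d) / hamming R e d).

Definition is_lipschitz_map (R : realType) (lam : R) (m : metricMap R) :=
  forall x y : msrc m, mdist (mfun m x) (mfun m y) <= lam * mdist x y.

Definition a_n (R : realType) (Fam : set (metricMap R)) (n : nat) : R :=
  inf [set a : R | 0 < a /\
    forall m, Fam m -> forall f : cube n -> msrc m,
      cubeE (fun e => mdist (mfun m (f e)) (mfun m (f (cneg e))))
        <= a * lipCube f].

Definition b_pn (R : realType) (Fam : set (metricMap R)) (p : R) (n : nat) : R :=
  inf [set b : R | 0 < b /\
    forall m, Fam m -> forall f : cube n -> msrc m,
      cubeE (fun e => mdist (mfun m (f e)) (mfun m (f (cneg e))) `^ p)
        <= b `^ p * n%:R `^ (p - 1) *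
           \sum_(i < n) cubeE (fun e => mdist (f e) (f (cflip i e)) `^ p)].

Definition factors_cube (R : realType) n (m : metricMap R) (f : cube n -> msrc m)
    (a b D : R) :=
  forall e d : cube n,
    (a / D) * hamming R e d <= mdist (f e) (f d) /\
    mdist (f e) (f d) <= a * D * hamming R e d /\
    (b / D) * hamming R e d <= mdist (mfun m (f e)) (mfun m (f d)) /\
    mdist (mfun m (f e)) (mfun m (f d)) <= b * D * hamming R e d.

Definition crudely_factors (R : realType) (Fam : set (metricMap R)) :=
  exists c D : R, 0 < c /\ 0 < D /\
    forall n : nat, (0 < n)%N ->
      exists m, Fam m /\ exists f : cube n -> msrc m, exists a b : R,
        0 < a /\ 0 < b /\ a * c <= b /\ factors_cube f a b D.

Definition factors (R : realType) (Fam : set (metricMap R)) :=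
  exists c : R, 0 < c /\
    forall D : R, 1 < D -> forall n : nat, (0 < n)%N ->
      exists m, Fam m /\ exists f : cube n -> msrc m, exists a b : R,
        0 < a /\ 0 < b /\ a * c <= b /\ factors_cube f a b D.

(* Main.v *)
(* The chain (i) => (ii) => (iii) => (iv) => (v) is elementary: a crude factorization forces [a_n >= c / D^2], and Jensen's inequality gives [a_n <= b_pn].

   For (v) => (i), let [E_X k] be the sum, over base points [e] and permutations [s] of the coordinates, of [k (d / k)^p], where [d] is the distance in X between the images of [e] and of [e] flipped along a random k-subset [s]; define [E_Y] likewise. Both are subadditive in [k], so [E_X k / k] and [E_Y k / k] do not increase along [k = M^j], while a lower bound on [b_pn] keeps [E_Y k / k] above a fixed multiple of [E_X 1]. By pigeonhole there is a scale [k] where both quotients hardly change from [k] to [M k]. At this scale, flipping M disjoint random blocks of k coordinates embeds the M-cube so that on average the triangle inequality through any intermediate vertex is almost an equality, in the p-th power sense, for both metrics at once. One linear combination of these quantities has a positive mean, so some choice of blocks makes all of them small simultaneously; strict convexity of [x^p] then makes both images nearly isometric to the Hamming cube, with ratio bounded below. *)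
Require Import Defs.
From mathcomp Require Import all_boot all_order all_algebra.
From mathcomp Require Import all_classical all_reals all_analysis.
From mathcomp Require Import perm lra ring zify.
Import Order.TTheory GRing.Theory Num.Theory.
Local Open Scope ring_scope.
Local Open Scope classical_set_scope.
(* [mdist] is shadowed by the homonym of MathComp-Analysis. *)
Import Defs.


(** * Power convexity *)
Section PowerConvexity.
Context {R : realType}.
Implicit Types p x y s u v : R.

(** Strictness away from 1 is the source of the rigidity: it lets a small [bern_gap] force [y] close
    to 1. *)
Lemma powR_bernoulli_strict p y : 1 < p -> 0 <= y -> y != 1 ->
  1 + p * (y - 1) < y `^ p.
Proof.
move=> p1; rewrite le_eqVlt => /orP[/eqP <- _|y0 y1].
  by rewrite powR0 ?gt_eqF //; lra.
(* Tangent lines at [t = ln y] to [exp], evaluated at [p t] and at [0]. *)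
have t0 : ln y != 0 by rewrite ln_eq0 ?y1 // posrE.
have yE : y = expR (ln y) by rewrite lnK ?posrE.
rewrite /powR gt_eqF //; set t := ln y in t0 yE *.
have h1 : y * (1 + (p - 1) * t) <= expR (p * t).
  have -> : p * t = t + (p - 1) * t by lra.
  by rewrite expRD -yE ler_pM2l // expR_ge1Dx.
have h2 : y * (1 - t) < 1.
  have y1E : y * expR (- t) = 1 by rewrite expRN -yE divff ?gt_eqF.
  by rewrite -[ltRHS]y1E ltr_pM2l // expR_gt1Dx // oppr_eq0.
have : (p - 1) * (y * (1 - t)) < (p - 1) * 1 by rewrite ltr_pM2l // subr_gt0.
nra.
Qed.

Lemma powR_bernoulli p y : 1 < p -> 0 <= y -> 1 + p * (y - 1) <= y `^ p.
Proof.
move=> p1 y0; case: (eqVneq y 1) => [->|y1]; first by rewrite powR1; lra.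
exact/ltW/powR_bernoulli_strict.
Qed.

(** This is [powR_bernoulli] at [x / s], scaled by [s ^ p]; at [s = 0] the slope vanishes because
    [p - 1] is positive. *)
Lemma powR_tangent p x s : 1 < p -> 0 <= x -> 0 <= s ->
  s `^ p + p * s `^ (p - 1) * (x - s) <= x `^ p.
Proof.
move=> p1 x0; rewrite le_eqVlt => /orP[/eqP <-|s0].
  rewrite !powR0 ?subr_eq0 ?gt_eqF //; last by lra.
  by rewrite mulr0 mul0r add0r powR_ge0.
have sp : s `^ p = s `^ (p - 1) * s.
  rewrite -[X in _ * X](powRr1 (ltW s0)) -powRD ?subrK //.
  by apply/implyP => _; rewrite gt_eqF.
have := powR_bernoulli p (x / s) p1 (divr_ge0 x0 (ltW s0)).
have -> : x `^ p = s `^ p * (x / s) `^ p.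
  by rewrite -powRM ?divr_ge0 ?(ltW s0) // mulrC divfK // gt_eqF.
rewrite -(ler_pM2l (powR_gt0 p s0)); apply: le_trans.
rewrite sp le_eqVlt; apply/orP; left; apply/eqP.
by field; rewrite gt_eqF.
Qed.

(** The Bregman divergence of the [p]-th power between [y] and 1. *)
Definition bern_gap p y := y `^ p - 1 - p * (y - 1).

Lemma bern_gap_ge0 p y : 1 < p -> 0 <= y -> 0 <= bern_gap p y.
Proof. by move=> p1 y0; rewrite /bern_gap; have := powR_bernoulli p y p1 y0; lra. Qed.

Lemma bern_gap_stable p (e : R) : 1 < p -> 0 < e -> e < 1 ->
  exists2 k : R, 0 < k & forall y, 0 <= y -> bern_gap p y <= k ->
    1 - e <= y <= 1 + e.
Proof.
move=> p1 e0 e1.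
have gap z : 0 <= z -> z != 1 -> 0 < bern_gap p z.
  by move=> z0 z1; rewrite /bern_gap; have := powR_bernoulli_strict p z p1 z0 z1; lra.
have g1 : 0 < bern_gap p (1 + e) by apply: gap; [lra|rewrite gt_eqF; lra].
have g2 : 0 < bern_gap p (1 - e) by apply: gap; [lra|rewrite lt_eqF; lra].
(* [bern_gap] is convex with minimum at 1, hence monotone on either side. *)
have tan z y : 0 <= z -> 0 <= y ->
    p * (z `^ (p - 1) - 1) * (y - z) <= bern_gap p y - bern_gap p z.
  by move=> z0 y0; rewrite /bern_gap; have := powR_tangent p y z p1 y0 z0; lra.
(* Halving turns the bound on the gap into strict inequalities against both endpoint values. *)
exists (Num.min (bern_gap p (1 + e)) (bern_gap p (1 - e)) / 2).
  by rewrite divr_gt0 // lt_min g1 g2.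
move=> y y0 hy.
have hy1 : bern_gap p y < bern_gap p (1 + e).
  have : Num.min (bern_gap p (1 + e)) (bern_gap p (1 - e)) <= bern_gap p (1 + e).
    by rewrite ge_min lexx.
  lra.
have hy2 : bern_gap p y < bern_gap p (1 - e).
  have : Num.min (bern_gap p (1 + e)) (bern_gap p (1 - e)) <= bern_gap p (1 - e).
    by rewrite ge_min lexx orbT.
  lra.
have pm : 0 <= p - 1 by lra.
have one : 1 `^ (p - 1) = 1 :> R by rewrite powR1.
apply/andP; split; rewrite leNgt; apply/negP => hlt.
  have h := tan (1 - e) y ltac:(lra) y0.
  have : (1 - e) `^ (p - 1) <= 1.
    rewrite -[leRHS]one.
    by apply: ge0_ler_powR; rewrite ?nnegrE; lra.
  move=> hh; have : 0 <= p * (1 - (1 - e) `^ (p - 1)) * (1 - e - y).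
    by apply: mulr_ge0; [apply: mulr_ge0|]; lra.
  lra.
have h := tan (1 + e) y ltac:(lra) y0.
have : 1 <= (1 + e) `^ (p - 1).
  rewrite -[leLHS]one.
  by apply: ge0_ler_powR; rewrite ?nnegrE; lra.
move=> hh; have : 0 <= p * ((1 + e) `^ (p - 1) - 1) * (y - (1 + e)).
  by apply: mulr_ge0; [apply: mulr_ge0|]; lra.
lra.
Qed.

(* The perspective of [x^p]; it vanishes at [u = 0], where the division gives 0. *)
Definition persp p u x := u * (x / u) `^ p.

Lemma persp_ge0 p u x : 0 <= u -> 0 <= persp p u x.
Proof. by move=> u0; rewrite mulr_ge0 ?powR_ge0. Qed.

Lemma persp_tangent p u x s : 1 < p -> 0 < u -> 0 <= x -> 0 <= s ->
  u * s `^ p + p * s `^ (p - 1) * (x - u * s) <= persp p u x.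
Proof.
move=> p1 u0 x0 s0; rewrite /persp.
have := powR_tangent p (x / u) s p1 (divr_ge0 x0 (ltW u0)) s0.
rewrite -(ler_pM2l u0); apply: le_trans; rewrite le_eqVlt; apply/orP; left.
by apply/eqP; field; rewrite gt_eqF.
Qed.

Lemma le_persp p u x y : 1 < p -> 0 <= u -> 0 <= x -> x <= y ->
  persp p u x <= persp p u y.
Proof.
move=> p1 u0 x0 xy; rewrite /persp ler_wpM2l //.
apply: ge0_ler_powR; rewrite ?nnegrE; first by lra.
- by rewrite divr_ge0.
- by rewrite divr_ge0 // (le_trans x0).
- by rewrite ler_wpM2r // invr_ge0.
Qed.

(** The tangents of the two terms at the common slope [s] have linear parts that cancel. This
    subadditivity is what makes the triangle inequality usable with [p]-th powers. *)
Lemma perspD p u v x y : 1 < p -> 0 < u -> 0 < v -> 0 <= x -> 0 <= y ->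
  persp p (u + v) (x + y) <= persp p u x + persp p v y.
Proof.
move=> p1 u0 v0 x0 y0.
set s := (x + y) / (u + v).
have s0 : 0 <= s by rewrite /s divr_ge0; lra.
have h1 := persp_tangent p u x s p1 u0 x0 s0.
have h2 := persp_tangent p v y s p1 v0 y0 s0.
have : persp p (u + v) (x + y) = (u + v) * s `^ p by [].
have : s * (u + v) = x + y by rewrite /s divfK // gt_eqF //; lra.
move=> hs ->; rewrite -/s.
have : p * s `^ (p - 1) * (x - u * s) + p * s `^ (p - 1) * (y - v * s) = 0.
  rewrite -mulrDr (_ : x - u * s + (y - v * s) = x + y - s * (u + v)); last by ring.
  by rewrite hs subrr mulr0.
lra.
Qed.

Lemma perspMr p u x (c : R) : 0 <= c -> 0 <= u -> 0 <= x ->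
  persp p u (c * x) = c `^ p * persp p u x.
Proof. by move=> c0 u0 x0; rewrite /persp -mulrA powRM ?divr_ge0 // mulrCA. Qed.

Lemma persp0 p u : 1 < p -> persp p u 0 = 0.
Proof. by move=> p1; rewrite /persp mul0r powR0 ?mulr0 // gt_eqF //; lra. Qed.

Lemma jensen_powR p (I : finType) (g : I -> R) : 1 < p ->
  (forall i, 0 <= g i) -> (0 < #|I|)%N ->
  ((\sum_i g i) / #|I|%:R) `^ p <= (\sum_i g i `^ p) / #|I|%:R.
Proof.
move=> p1 g0 I0; set N := #|I|%:R : R; set s := _ / N.
have N0 : 0 < N by rewrite ltr0n.
have s0 : 0 <= s by rewrite divr_ge0 ?sumr_ge0 // ltW.
rewrite ler_pdivlMr //.
(* Tangents at the mean [s]: the linear terms sum to zero. *)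
have : \sum_i (s `^ p + p * s `^ (p - 1) * (g i - s)) <= \sum_i g i `^ p.
  by apply: ler_sum => i _; exact: powR_tangent.
rewrite big_split /= -mulr_sumr sumrB !sumr_const.
have -> : \sum_i g i = s * N by rewrite /s divfK // gt_eqF.
by rewrite -[s *+ _]mulr_natr subrr mulr0 addr0 -[s `^ p *+ _]mulr_natr.
Qed.

End PowerConvexity.

(** * Near-equality in the triangle inequality on a cube *)

(** A boolean vector serves both as a vertex and as a set of coordinates: [cxor e w] is [e] with the
    coordinates in [w] flipped, and [cwt w] is the size of [w]. *)
Definition cxor {n} (e d : cube n) : cube n := [ffun i => e i (+) d i].
Definition czero n : cube n := [ffun=> false].
Definition cwt {n} (w : cube n) : nat := #|[pred i | w i]|.

(** * The cube as a group under exclusive or *)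

Section Cube.
Variable n : nat.
Implicit Types e d w : cube n.

Lemma cxorA e d w : cxor e (cxor d w) = cxor (cxor e d) w.
Proof. by apply/ffunP => i; rewrite !ffunE addbA. Qed.

Lemma cxorC e d : cxor e d = cxor d e.
Proof. by apply/ffunP => i; rewrite !ffunE addbC. Qed.

Lemma cxorvv e : cxor e e = czero n.
Proof. by apply/ffunP => i; rewrite !ffunE addbb. Qed.

Lemma cxor0 e : cxor e (czero n) = e.
Proof. by apply/ffunP => i; rewrite !ffunE addbF. Qed.

Lemma cxor0l e : cxor (czero n) e = e.
Proof. by rewrite cxorC cxor0. Qed.

Lemma cxorK e d : cxor e (cxor e d) = d.
Proof. by rewrite cxorA cxorvv cxor0l. Qed.

Lemma cxorKr e d : cxor (cxor d e) e = d.
Proof. by rewrite -cxorA cxorvv cxor0. Qed.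

Lemma cneg_cxor e : cneg e = cxor e (cneg (czero n)).
Proof. by apply/ffunP => i; rewrite !ffunE addbT. Qed.

Lemma cnegK e : cneg (cneg e) = e.
Proof. by apply/ffunP => i; rewrite !ffunE negbK. Qed.

Lemma cxor_cneg e d : cxor e (cneg d) = cneg (cxor e d).
Proof. by rewrite [cneg d]cneg_cxor cxorA -cneg_cxor. Qed.

Lemma cwt0 : cwt (czero n) = 0%N.
Proof. by apply: eq_card0 => i; rewrite !inE ffunE. Qed.

Lemma cwt_eq0 w : cwt w = 0%N -> w = czero n.
Proof.
by move=> h; apply/ffunP => i; move: (card0_eq h i); rewrite !inE ffunE => ->.
Qed.

Lemma cwt_neg w : (cwt w + cwt (cneg w))%N = n.
Proof.
rewrite -[RHS](card_ord n) -(cardC [pred i | w i]); congr (_ + _)%N.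
by apply: eq_card => i; rewrite !inE ffunE.
Qed.

Lemma cwt_one : cwt (cneg (czero n)) = n.
Proof. by have := cwt_neg (czero n); rewrite cwt0. Qed.

Lemma hammingE (R : realType) e d : hamming R e d = (cwt (cxor e d))%:R / n%:R.
Proof.
rewrite /hamming; congr (_%:R / _); apply: eq_card => i.
rewrite (_ : (i \in [set i | e i != d i]) = (e i != d i)).
  by rewrite !inE ffunE; case: (e i) (d i) => [] [].
by apply/idP/idP => [/set_mem//|h]; apply/mem_set.
Qed.

Lemma hamming_neg (R : realType) e : (0 < n)%N -> hamming R e (cneg e) = 1.
Proof.
move=> n0; rewrite hammingE cneg_cxor cxorK cwt_one divff //.
by rewrite pnatr_eq0 -lt0n.
Qed.

End Cube.

(** * From small defects to near-isometry *)

Section Stability.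
Context {R : realType}.

(** Only a pseudometric, so that pullbacks along maps that are not injective qualify. *)
Definition pmetric {T : Type} (r : T -> T -> R) :=
  [/\ forall x, r x x = 0, forall x y, r x y = r y x &
      forall x y z, r x z <= r x y + r y z].

Lemma pmetric_ge0 T (r : T -> T -> R) : pmetric r -> forall x y, 0 <= r x y.
Proof.
by case=> r0 rC rT x y; have := rT x y x; rewrite r0 (rC y x); lra.
Qed.

(** Splits the cost of a leg, relative to a slope [a], into a convexity gap, its mass and a linear
    excess. Over two legs, with [a] the slope of the direct distance, the excesses add up to a
    multiple of the triangle slack. *)
Lemma persp_gap (p u x a : R) : 0 <= u -> (u = 0 -> x = 0) -> 0 <= x -> 0 < a ->
  persp p u x =
  a `^ p * (u * bern_gap p (x / (u * a)) + u + p * (x / a - u)).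
Proof.
move=> u0 ux x0 a0; case: (eqVneq u 0) => [uE|un0].
  by rewrite ux // uE /persp !mul0r subrr !mulr0 !addr0 mulr0.
have {}u0 : 0 < u by rewrite lt_def un0.
have xE : x / u = a * (x / (u * a)).
  by field; rewrite un0 gt_eqF.
rewrite /persp xE powRM ?(ltW a0) ?divr_ge0 ?mulr_ge0 ?(ltW a0) ?(ltW u0) //.
rewrite /bern_gap; set y := _ `^ p; set z := a `^ p.
by field; rewrite un0 gt_eqF.
Qed.

(** By [persp_gap], the extra cost of the detour is [a ^ p] times the sum of two weighted gaps and a
    multiple of the triangle slack, all nonnegative; so the gap of the first leg is small. The
    alternative [u = 0] covers a degenerate leg. *)
Lemma two_leg_stable (p e : R) : 1 < p -> 0 < e -> e < 1 ->
  exists2 k : R, 0 < k & forall (u v x y t k' : R),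
    0 <= u -> 0 <= v -> (u = 0 -> x = 0) -> (v = 0 -> y = 0) ->
    0 <= x -> 0 <= y -> 0 < t -> t <= x + y -> 0 < u + v ->
    k' * (u + v) <= k * u \/ u = 0 ->
    persp p u x + persp p v y - persp p (u + v) t <= k' * persp p (u + v) t ->
    (1 - e) * (u * (t / (u + v))) <= x <= (1 + e) * (u * (t / (u + v))).
Proof.
move=> p1 e0 e1; have [k k0 hk] := bern_gap_stable p e p1 e0 e1.
exists k => // u v x y t k' u0 v0 ux vy x0 y0 t0 txy uv0 hku hd.
case: hku => [hku|uE]; last by rewrite ux // uE !mul0r !mulr0 lexx.
case: (eqVneq u 0) => [uE|un0]; first by rewrite ux // uE !mul0r !mulr0 lexx.
set a := t / (u + v).
have a0 : 0 < a by rewrite divr_gt0.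
have {}u0 : 0 < u by rewrite lt_def un0.
have ta : t = (u + v) * a by rewrite /a mulrC divfK // gt_eqF.
have apos : 0 < a `^ p by rewrite powR_gt0.
have gx0 : 0 <= x / (u * a) by apply: divr_ge0 => //; apply: mulr_ge0; exact: ltW.
have gy0 : 0 <= y / (v * a) by apply: divr_ge0 => //; apply: mulr_ge0 => //; exact: ltW.
have gy := bern_gap_ge0 p _ p1 gy0.
have hh : bern_gap p (x / (u * a)) <= k.
  have pt : persp p (u + v) t = a `^ p * (u + v) by rewrite mulrC.
  move: hd; rewrite pt (persp_gap p u x a) ?(ltW u0) //.
  rewrite (persp_gap p v y a) //.
  set gX := bern_gap p (x / _) in gy *; set gY := bern_gap p (y / _) in gy *.
  rewrite -mulrDr -mulrBr mulrCA ler_pM2l // => hd.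
  have : 0 <= p * ((x + y) / a - (u + v)).
    rewrite mulr_ge0 //; first by lra.
    by rewrite subr_ge0 ler_pdivlMr // -ta.
  rewrite mulrDl => h2.
  have h3 : 0 <= v * gY by rewrite mulr_ge0.
  by rewrite -(ler_pM2l u0) [u * k]mulrC; lra.
have /andP[h1 h2] := hk _ gx0 hh; have ua : 0 < u * a by rewrite mulr_gt0.
by rewrite -ler_pdivlMr // h1 -ler_pdivrMr.
Qed.

(* The slack of the triangle inequality between [d] and its antipode through [cxor d w], measured with p-th powers. *)
Definition defect (p s : R) {M} (r : cube M -> cube M -> R) (d w : cube M) : R :=
  persp p (s * (cwt w)%:R) (r d (cxor d w)) +
  persp p (s * (cwt (cneg w))%:R) (r (cxor d w) (cneg d)) -
  persp p (s * M%:R) (r d (cneg d)).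

Lemma scale_cwt (s : R) M (w : cube M) :
  s * (cwt w)%:R + s * (cwt (cneg w))%:R = s * M%:R.
Proof. by rewrite -mulrDr -natrD cwt_neg. Qed.

Lemma pmetric_cwt0 (s : R) M (r : cube M -> cube M -> R) (d w : cube M) :
  0 < s -> pmetric r -> s * (cwt w)%:R = 0 -> r d (cxor d w) = 0.
Proof.
move=> s0 rP /eqP; rewrite mulf_eq0 gt_eqF //= pnatr_eq0 => /eqP /cwt_eq0 ->.
by rewrite cxor0; case: rP.
Qed.

Lemma pmetric_cwt0_neg (s : R) M (r : cube M -> cube M -> R) (d w : cube M) :
  0 < s -> pmetric r -> s * (cwt (cneg w))%:R = 0 -> r (cxor d w) (cneg d) = 0.
Proof.
move=> s0 rP h; have := pmetric_cwt0 s M r (cxor d w) (cneg w) s0 rP h.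
by rewrite -cxorA cxor_cneg cxorvv -cneg_cxor.
Qed.

(** The triangle inequality followed by [perspD]; as the latter wants positive masses, degenerate
    legs are treated apart. *)
Lemma defect_ge0 (p s : R) M (r : cube M -> cube M -> R) (d w : cube M) :
  1 < p -> 0 < s -> pmetric r -> 0 <= defect p s r d w.
Proof.
move=> p1 s0 rP; have r0 := pmetric_ge0 _ _ rP.
rewrite /defect subr_ge0 -(scale_cwt s M w).
have tri : r d (cneg d) <= r d (cxor d w) + r (cxor d w) (cneg d) by case: rP.
apply: le_trans (le_persp p _ _ _ p1 _ (r0 _ _) tri) _.
  by rewrite addr_ge0 // mulr_ge0 // ltW.
have [h|h] := eqVneq (s * (cwt w)%:R) 0.
  by rewrite (pmetric_cwt0 s M r d w) // h !add0r (persp0 p _ p1) add0r.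
have [h'|h'] := eqVneq (s * (cwt (cneg w))%:R) 0.
  by rewrite (pmetric_cwt0_neg s M r d w) // h' !addr0 (persp0 p _ p1) addr0.
apply: perspD => //; rewrite lt_def ?h ?h' /= mulr_ge0 //; exact: ltW.
Qed.

Lemma defect_stable (p e : R) M : 1 < p -> (0 < M)%N -> 0 < e -> e < 1 ->
  exists2 k : R, 0 < k & forall (s : R) (r : cube M -> cube M -> R) (d : cube M),
    0 < s -> pmetric r -> 0 < r d (cneg d) ->
    (forall w, defect p s r d w <= k * persp p (s * M%:R) (r d (cneg d))) ->
    forall w, (1 - e) * ((cwt w)%:R / M%:R * r d (cneg d)) <= r d (cxor d w)
                <= (1 + e) * ((cwt w)%:R / M%:R * r d (cneg d)) /\
              (1 - e) * ((cwt (cneg w))%:R / M%:R * r d (cneg d))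
                <= r (cxor d w) (cneg d)
                <= (1 + e) * ((cwt (cneg w))%:R / M%:R * r d (cneg d)).
Proof.
move=> p1 M0 e0 e1; have [k k0 hk] := two_leg_stable p e p1 e0 e1.
have MR : 0 < M%:R :> R by rewrite ltr0n.
(* A nonempty [w] has weight at least 1, so dividing by [M] gives one threshold that suits every
   nondegenerate leg in [two_leg_stable]. *)
exists (k / M%:R); first by rewrite divr_gt0.
move=> s r d s0 rP t0 hd w.
have r0 := pmetric_ge0 _ _ rP.
have cw := scale_cwt s M w.
have z1 d' w' := pmetric_cwt0 s M r d' w' s0 rP.
have z2 := pmetric_cwt0_neg s M r d w s0 rP.
have small (w' : cube M) : k / M%:R * (s * M%:R) <= k * (s * (cwt w')%:R) \/
    s * (cwt w')%:R = 0.
  have [->|h] := posnP (cwt w'); first by right; rewrite mulr0.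
  left; rewrite (_ : _ * _ = k * s); last by field; rewrite gt_eqF.
  by rewrite mulrA ler_pMr ?mulr_gt0 // ler1n.
have scale (w' : cube M) : s * (cwt w')%:R * (r d (cneg d) / (s * M%:R)) =
    (cwt w')%:R / M%:R * r d (cneg d).
  by field; rewrite !gt_eqF.
have tri : r d (cneg d) <= r d (cxor d w) + r (cxor d w) (cneg d) by case: rP.
have wp (w' : cube M) : 0 <= s * (cwt w')%:R by rewrite mulr_ge0 // ltW.
have sM : 0 < s * M%:R by rewrite mulr_gt0.
have dw := hd w; rewrite /defect in dw.
split.
  rewrite -!scale -cw.
  by apply: (hk _ _ _ (r (cxor d w) (cneg d)) _ (k / M%:R)) => //;
    rewrite ?cw //; first [exact: z1|exact: small].
rewrite -!scale -cw [s * (cwt w)%:R + _]addrC.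
apply: (hk _ _ _ (r d (cxor d w)) _ (k / M%:R)) => //;
  rewrite 1?[s * (cwt (cneg w))%:R + _]addrC ?cw //.
1: exact: z1.
1: by rewrite addrC.
by rewrite [persp p _ (r (cxor d w) _) + _]addrC.
Qed.

Lemma perspZ (p s u m c t : R) : 0 < s -> 0 <= u -> 0 < m -> 0 <= c -> 0 <= t ->
  persp p (s * u) (c * (u / m * t)) = u / m * (c `^ p * persp p (s * m) t).
Proof.
move=> s0; rewrite le_eqVlt => /orP[/eqP <-|u0] m0 c0 t0.
  by rewrite /persp mulr0 !mul0r.
rewrite /persp (_ : c * (u / m * t) / (s * u) = c * (t / (s * m))); last first.
  by field; rewrite !gt_eqF.
rewrite powRM ?divr_ge0 ?mulr_ge0 // ?(ltW s0) ?(ltW m0) //.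
by set a := _ `^ p; set b := _ `^ p; field; rewrite gt_eqF.
Qed.

(** Every antipodal distance is first compared with the single reference [t], then [defect_stable]
    is applied at each [d]. The two approximations multiply, whence the squares. *)
Lemma cube_stability (p e : R) M : 1 < p -> (0 < M)%N -> 0 < e -> e < 1 ->
  exists2 k : R, 0 < k & forall (s : R) (r : cube M -> cube M -> R) (t : R),
    0 < s -> pmetric r -> t = r (czero M) (cneg (czero M)) -> 0 < t ->
    (forall d w, defect p s r d w <= k * persp p (s * M%:R) t) ->
    forall d w, (1 - e) ^+ 2 * ((cwt w)%:R / M%:R * t) <= r d (cxor d w)
                <= (1 + e) ^+ 2 * ((cwt w)%:R / M%:R * t).
Proof.
(* With this [e'], Bernoulli gives [(1 - e') ^ p >= 1 - e / 2]. *)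
move=> p1 M0 e0 e1; pose e' := e / (2 * p).
have pp : 0 < p by lra.
have e'0 : 0 < e' by rewrite divr_gt0 //; lra.
have pe' : p * e' = e / 2 by rewrite /e'; field; rewrite gt_eqF.
have e'e : e' <= e / 2 by rewrite -pe' ler_peMl // ltW.
have [|k1 k10 h1] := defect_stable p e' M p1 M0 e'0; first by lra.
have [k2 k20 h2] := defect_stable p e M p1 M0 e0 e1.
have MR : 0 < M%:R :> R by rewrite ltr0n.
have q0 : 0 < (1 - e) `^ p by rewrite powR_gt0; lra.
(* [k1] serves at [czero M]; the factor [(1 - e) ^ p] pays for replacing [t] by the antipodal
   distance at [d]; [e / 4] leaves room for the contradiction proving [td_lo]. *)
pose k := Num.min k1 (Num.min (k2 * (1 - e) `^ p) (e / 4)).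
have k0 : 0 < k.
  by rewrite !lt_min k10 mulr_gt0 //=; lra.
have kk1 : k <= k1 by rewrite ge_min lexx.
have kk2 : k <= k2 * (1 - e) `^ p by rewrite !ge_min lexx orbT.
have ke : k <= e / 4 by rewrite !ge_min lexx !orbT.
exists k => // s r t s0 rP tE t0 hd d w.
have r0 := pmetric_ge0 _ _ rP.
have rC : forall x y, r x y = r y x by case: rP.
have rT : forall x y z, r x z <= r x y + r y z by case: rP.
set P := persp p (s * M%:R) t in hd.
have sM : 0 < s * M%:R by rewrite mulr_gt0.
have P0 : 0 < P by rewrite mulr_gt0 // powR_gt0 // divr_gt0.
have near0 v : (1 - e') * ((cwt (cneg v))%:R / M%:R * t) <= r v (cneg (czero M))
    <= (1 + e') * ((cwt (cneg v))%:R / M%:R * t).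
  have h := h1 s r (czero M) s0 rP; rewrite -tE -/P in h.
  have hk v' : defect p s r (czero M) v' <= k1 * P.
    by apply: le_trans (hd _ _) _; rewrite ler_pM2r.
  by have [_] := h t0 hk v; rewrite cxor0l.
have cM (v : cube M) : (cwt v)%:R + (cwt (cneg v))%:R = M%:R :> R.
  by rewrite -natrD cwt_neg.
have MRn : M%:R != 0 :> R by rewrite gt_eqF.
have wMt (v : cube M) z : (cwt v)%:R / M%:R * z + (cwt (cneg v))%:R / M%:R * z = z :> R.
  by rewrite -2!mulrDl cM divff // mul1r.
(* Both halves of a path from [d] to its antipode through the vertex opposite to [czero M] are controlled by the defects at [czero M]; hence all antipodal distances are close to [t]. *)
set td := r d (cneg d).
have /andP[lo1 up1] := near0 d.
have /andP[lo2 up2] := near0 (cneg d); rewrite cnegK in lo2 up2.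
have td_up : td <= (1 + e) * t.
  apply: (le_trans (rT d (cneg (czero M)) (cneg d))); rewrite (rC _ (cneg d)).
  have : (1 + e') * ((cwt d)%:R / M%:R * t) +
      (1 + e') * ((cwt (cneg d))%:R / M%:R * t) = (1 + e') * t.
    by rewrite -mulrDr wMt.
  have : (1 + e') * t <= (1 + e) * t by rewrite ler_pM2r //; lra.
  lra.
have td_lo : (1 - e) * t <= td.
  rewrite leNgt; apply/negP => hlt.
  have hu : persp p (s * M%:R) td <= (1 - e) `^ p * P.
    rewrite -perspMr ?(ltW sM) ?(ltW t0) //; last by lra.
    by apply: le_persp; rewrite ?(ltW sM) ?(ltW hlt) // r0.
  have hb : (1 - e) `^ p <= 1 - e.
    rewrite -[leRHS]powRr1; last by lra.
    by apply: ger_powR; [apply/andP; split|]; lra.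
  (* The path from [d] through [cneg (czero M)] costs at least [(1 - e / 2) * P], while a short [td]
     costs at most [(1 - e) * P]; the defect would then be at least [e / 2 * P], more than
     [k * P]. *)
  have := hd d (cneg d).
  rewrite /defect cxor_cneg cxorvv cnegK -/td => hdef.
  have l1 : persp p (s * (cwt (cneg d))%:R) ((1 - e') * ((cwt (cneg d))%:R / M%:R * t))
      <= persp p (s * (cwt (cneg d))%:R) (r d (cneg (czero M))).
    apply: le_persp => //; first by rewrite mulr_ge0 // ltW.
    by rewrite !mulr_ge0 ?invr_ge0 // ?(ltW t0) //; lra.
  have l2 : persp p (s * (cwt d)%:R) ((1 - e') * ((cwt d)%:R / M%:R * t))
      <= persp p (s * (cwt d)%:R) (r (cneg (czero M)) (cneg d)).
    rewrite (rC (cneg (czero M))); apply: le_persp => //.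
      by rewrite mulr_ge0 // ltW.
    by rewrite !mulr_ge0 ?invr_ge0 // ?(ltW t0) //; lra.
  rewrite perspZ ?(ltW t0) // in l1; last by lra.
  rewrite perspZ ?(ltW t0) // -/P in l2; last by lra.
  rewrite -/P in l1.
  have sum : (cwt (cneg d))%:R / M%:R * ((1 - e') `^ p * P) +
      (cwt d)%:R / M%:R * ((1 - e') `^ p * P) = (1 - e') `^ p * P.
    by rewrite addrC wMt.
  have hB := powR_bernoulli p (1 - e') p1 ltac:(lra).
  have hB' : (1 - e / 2) * P <= (1 - e') `^ p * P by rewrite ler_pM2r //; lra.
  have hk : k * P <= e / 4 * P by rewrite ler_pM2r.
  have hb' : (1 - e) `^ p * P <= (1 - e) * P by rewrite ler_pM2r.
  have : 0 < e * P by rewrite mulr_gt0.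
  lra.
have td0 : 0 < td.
  by apply: lt_le_trans td_lo; rewrite mulr_gt0 //; lra.
have Ptd : (1 - e) `^ p * P <= persp p (s * M%:R) td.
  rewrite -perspMr ?(ltW sM) ?(ltW t0) //; last by lra.
  by apply: le_persp; rewrite ?(ltW sM) // mulr_ge0 ?(ltW t0) //; lra.
have [|/andP[lo up] _] := h2 s r d s0 rP td0 _ w.
  move=> v; apply: le_trans (hd _ _) _.
  apply: (@le_trans _ _ (k2 * (1 - e) `^ p * P)); first by rewrite ler_pM2r.
  by rewrite -mulrA ler_pM2l.
have c0 : 0 <= (cwt w)%:R / M%:R :> R by rewrite divr_ge0.
apply/andP; split.
  apply: le_trans lo; rewrite expr2 -mulrA ler_pM2l; last by lra.
  by rewrite mulrCA ler_wpM2l.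
apply: le_trans up _; rewrite expr2 -[leRHS]mulrA ler_pM2l; last by lra.
by rewrite [leRHS]mulrCA ler_wpM2l.
Qed.

End Stability.

(** * Averaging over base points and coordinate permutations *)

Definition cperm {n} (s : {perm 'I_n}) (w : cube n) : cube n :=
  [ffun i => w (s i)].

Definition cini (n k : nat) : cube n := [ffun i : 'I_n => (i < k)%N].

(** Repeats each coordinate of [d] over a block of [k] coordinates; past the last block [insub]
    fails and the default [false] flips nothing. *)
Definition cblk {M} (n k : nat) (d : cube M) : cube n :=
  [ffun x : 'I_n => oapp d false (insub (x %/ k)%N)].

Section CubePerm.
Variable n : nat.
Implicit Types (s : {perm 'I_n}) (v w : cube n).

Lemma cperm_cxor s v w : cperm s (cxor v w) = cxor (cperm s v) (cperm s w).
Proof. by apply/ffunP => i; rewrite !ffunE. Qed.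

Lemma cpermM s t w : cperm s (cperm t w) = cperm (s * t)%g w.
Proof. by apply/ffunP => i; rewrite !ffunE permM. Qed.

(** Permutations act transitively on each weight level, since the weight determines the multiset of
    entries. *)
Lemma cwt_perm v w : cwt v = cwt w -> exists s, v = cperm s w.
Proof.
move=> vw.
have /tuple_permP [s hs] : perm_eq [tuple v i | i < n] [tuple w i | i < n].
  have cnt (u : cube n) b : count_mem b [tuple u i | i < n] =
      if b then cwt u else (n - cwt u)%N.
    have h : count_mem true [tuple u i | i < n] = cwt u.
      rewrite /= count_map /cwt cardE size_filter -enumT; apply: eq_count => i.
      by rewrite /= eqb_id.
    case: b => //; apply/eqP; rewrite -(eqn_add2l (cwt u)) subnKC; last first.
      by rewrite -[leqRHS](card_ord n) max_card.
    rewrite -h -[X in _ == X](size_tuple [tuple u i | i < n]).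
    rewrite -(count_predC (pred1 true)); apply/eqP; congr (_ + _)%N.
    by apply: eq_count => -[].
  by apply/allP => b _; apply/eqP; rewrite !cnt vw.
exists s; apply/ffunP => i; rewrite ffunE.
have : tnth [tuple v i | i < n] i = nth false [tuple v i | i < n] i.
  exact: tnth_nth.
by rewrite hs -tnth_nth !tnth_mktuple.
Qed.

Lemma cwt_cxor_disj v w : (forall i, ~~ (v i && w i)) ->
  cwt (cxor v w) = (cwt v + cwt w)%N.
Proof.
move=> h; rewrite /cwt -cardUI [X in (_ + X)%N]eq_card0 ?addn0.
  apply: eq_card => i; rewrite !inE ffunE.
  by have := h i; case: (v i) (w i) => [] [].
by move=> i; rewrite !inE; apply/negbTE.
Qed.

Lemma cwt_sum m (w : cube m) : cwt w = (\sum_(i < m) w i)%N.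
Proof. by rewrite /cwt -sum1_card big_mkcond. Qed.

Lemma cwt_cini k : (k <= n)%N -> cwt (cini n k) = k.
Proof.
move=> kn; transitivity (\sum_(0 <= i < n) (i < k))%N.
  by rewrite cwt_sum big_mkord; apply: eq_bigr => i _; rewrite ffunE.
rewrite (big_cat_nat (n := k)) //=.
rewrite [X in (_ + X)%N]big_nat [X in (_ + X)%N]big1 ?addn0; last first.
  by move=> i /andP[ki _]; rewrite ltnNge ki.
rewrite big_nat (eq_bigr (fun=> 1%N)) => [|i /andP[_ ->] //].
by rewrite -big_nat sum_nat_const_nat subn0 muln1.
Qed.

Lemma cblk_cxor M k (d e : cube M) :
  cblk n k (cxor d e) = cxor (cblk n k d) (cblk n k e).
Proof.
by apply/ffunP => x; rewrite !ffunE; case: insubP => //= j _ _; rewrite ffunE.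
Qed.

Lemma cwt_cblk M k (d : cube M) : (0 < k)%N -> (k * M <= n)%N ->
  cwt (cblk n k d) = (k * cwt d)%N.
Proof.
move=> k0 kM; pose D j : nat := oapp d false (insub j).
transitivity (\sum_(0 <= x < n) D (x %/ k)%N)%N.
  by rewrite cwt_sum big_mkord; apply: eq_bigr => x _; rewrite ffunE.
rewrite (big_cat_nat (n := (k * M)%N)) //= [X in (_ + X)%N]big_nat.
rewrite [X in (_ + X)%N]big1 ?addn0; last first.
  move=> i /andP[hi _]; rewrite /D insubN //= -leqNgt leq_divRL // mulnC //.
have -> : cwt d = (\sum_(0 <= j < M) D j)%N.
  by rewrite cwt_sum big_mkord; apply: eq_bigr => j _; rewrite /D valK.
(* Generalizing [D] frees the induction on [M] from [d], whose type depends on [M]. *)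
move: D => D; elim: M {d kM} => [|M IH]; first by rewrite muln0 !big_geq ?muln0.
rewrite (big_cat_nat (n := (k * M)%N)) ?leq_mul //= IH big_nat_recr //= mulnDr.
congr (_ + _)%N; rewrite mulnS -[X in (\sum_(X <= _ < _) _)%N]add0n big_addn addnK.
rewrite big_nat (eq_bigr (fun=> D M)) => [|i /andP[_ ik]].
  by rewrite -big_nat sum_nat_const_nat subn0.
by rewrite addnC mulnC divnMDl // divn_small // addn0.
Qed.

End CubePerm.

Section Energy.
Context {R : realType}.
Variables (p : R) (n : nat).
Hypothesis p1 : 1 < p.

(* Only [cwt w] matters, since [cperm s w] is a uniformly random vector of that weight. *)
Definition energy (r : cube n -> cube n -> R) (w : cube n) : R :=
  \sum_(s : {perm 'I_n}) \sum_(e : cube n)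
    persp p (cwt w)%:R (r e (cxor e (cperm s w))).

Definition energyk r k := energy r (cini n k).

(** For each [s] the translation is a bijection of the cube, so a uniform base point stays uniform.
    This lets the second leg of a path be treated as if it started at [e]. *)
Lemma sum_shift (H : {perm 'I_n} -> cube n -> R) (v : cube n) :
  \sum_(s : {perm 'I_n}) \sum_(e : cube n) H s (cxor e (cperm s v)) =
  \sum_(s : {perm 'I_n}) \sum_(e : cube n) H s e.
Proof.
apply: eq_bigr => s _; rewrite [RHS](reindex_inj (h := fun e => cxor e (cperm s v))) //.
by move=> a b /(congr1 (fun e => cxor e (cperm s v))); rewrite !cxorKr.
Qed.

Lemma energy_wt r v w : cwt v = cwt w -> energy r v = energy r w.
Proof.
move=> vw; have [t vE] := cwt_perm _ v w vw.
rewrite /energy vw vE [RHS](reindex_inj (mulIg t)); apply: eq_bigr => s _.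
by apply: eq_bigr => e _; rewrite cpermM.
Qed.

Lemma energy_ge0 r w : 0 <= energy r w.
Proof. by do 2!apply: sumr_ge0 => ? _; exact: persp_ge0. Qed.

(** Pointwise this is the triangle inequality through [cxor e (cperm s v)] with [perspD];
    [sum_shift] moves the second leg back to base point [e]. *)
Lemma energyD r (v w : cube n) : pmetric r -> (forall i, ~~ (v i && w i)) ->
  energy r (cxor v w) <= energy r v + energy r w.
Proof.
move=> rP vw; have r0 := pmetric_ge0 _ _ rP.
have [v0|v0] := posnP (cwt v).
  by rewrite (cwt_eq0 _ _ v0) cxor0l lerDr energy_ge0.
have [w0|w0] := posnP (cwt w).
  by rewrite (cwt_eq0 _ _ w0) cxor0 lerDl energy_ge0.
pose H s e := persp p (cwt w)%:R (r e (cxor e (cperm s w))).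
have -> : energy r w =
    \sum_(s : {perm 'I_n}) \sum_(e : cube n) H s (cxor e (cperm s v)).
  by rewrite sum_shift.
rewrite -big_split; apply: ler_sum => s _; rewrite -big_split; apply: ler_sum => e _.
rewrite /= (cwt_cxor_disj _ _ _ vw) natrD cperm_cxor cxorA.
apply: le_trans (perspD _ _ _ _ _ p1 _ _ (r0 _ _) (r0 _ _)); rewrite ?ltr0n //.
by apply: le_persp => //; rewrite -?natrD //; case: rP.
Qed.

Lemma energykD r j k : pmetric r -> (j + k <= n)%N ->
  energyk r (j + k) <= energyk r j + energyk r k.
Proof.
move=> rP jk; pose w : cube n := [ffun i : 'I_n => (j <= i < j + k)%N].
have dis i : ~~ (cini n j i && w i).
  by rewrite !ffunE; case: (ltnP i j).
have jw : cini n (j + k) = cxor (cini n j) w.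
  apply/ffunP => i; rewrite !ffunE; case: (ltnP i j) => ij; last by rewrite addFb.
  by rewrite ltn_addr.
have cw : cwt w = cwt (cini n k).
  apply/eqP; rewrite -(eqn_add2l (cwt (cini n j))) -cwt_cxor_disj // -jw.
  by rewrite !cwt_cini //; lia.
by rewrite /energyk jw -(energy_wt _ _ _ cw); exact: energyD.
Qed.

Lemma energykM r k q : pmetric r -> (k * q <= n)%N ->
  energyk r (k * q) <= q%:R * energyk r k.
Proof.
move=> rP; elim: q => [_|q IH kq].
  rewrite muln0 mul0r /energyk /energy cwt_cini // big1 // => s _.
  by rewrite big1 // => e _; rewrite /persp mul0r.
rewrite mulnS; apply: le_trans (energykD _ _ _ rP _) _; first by rewrite -mulnS.
by rewrite -[q.+1]add1n natrD mulrDl mul1r lerD2l IH //; lia.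
Qed.

Lemma energykn r : energyk r n =
  #|{perm 'I_n}|%:R * \sum_(e : cube n) persp p n%:R (r e (cneg e)).
Proof.
rewrite /energyk /energy cwt_cini // mulr_natl -sumr_const.
apply: eq_bigr => s _; apply: eq_bigr => e _; congr (persp _ _ (r _ _)).
by apply/ffunP => i; rewrite !ffunE ltn_ord addbT.
Qed.

(** All singletons have the same energy, so the [n] copies can be spread over the [n] singletons;
    each [s] then merely permutes the edge directions. *)
Lemma energyk1 r : n%:R * energyk r 1 =
  #|{perm 'I_n}|%:R * \sum_(i < n) \sum_(e : cube n) persp p 1 (r e (cflip i e)).
Proof.
pose u (x : 'I_n) : cube n := [ffun i => i == x].
have cu x : cwt (u x) = 1%N.
  by rewrite -(card1 x); apply: eq_card => i; rewrite !inE ffunE.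
transitivity (\sum_(x < n) energy r (u x)).
  rewrite mulr_natl -[X in _ *+ X](card_ord n) -sumr_const; apply: eq_bigr => x _.
  apply: energy_wt; rewrite cu cwt_cini //; exact: leq_ltn_trans (ltn_ord x).
rewrite exchange_big /= mulr_natl -sumr_const; apply: eq_bigr => s _.
rewrite (reindex_inj (@perm_inj _ s)) /=; apply: eq_bigr => x _.
rewrite cu; apply: eq_bigr => e _; congr (persp _ _ (r _ _)).
apply/ffunP => i; rewrite !ffunE (inj_eq perm_inj).
by case: eqP; rewrite ?addbT ?addbF.
Qed.

Lemma le_energy (L : R) rX rY w : 0 <= L -> pmetric rX -> pmetric rY ->
  (forall e d, rY e d <= L * rX e d) ->
  energy rY w <= L `^ p * energy rX w.
Proof.
move=> L0 rXP rYP h.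
rewrite mulr_sumr; apply: ler_sum => s _; rewrite mulr_sumr; apply: ler_sum => e _.
have rX0 := pmetric_ge0 _ _ rXP; have rY0 := pmetric_ge0 _ _ rYP.
by rewrite -perspMr //; exact: le_persp.
Qed.

(** * Random block embeddings of the [M]-cube *)

Definition block_metric {M} (k : nat) (r : cube n -> cube n -> R)
    (s : {perm 'I_n}) (e : cube n) (d d' : cube M) : R :=
  r (cxor e (cperm s (cblk n k d))) (cxor e (cperm s (cblk n k d'))).

Lemma block_pmetric M k r s e : pmetric r -> pmetric (@block_metric M k r s e).
Proof. by case=> r0 rC rT; split=> *; rewrite /block_metric. Qed.

(** An edge set [w] of the small cube flips [k * cwt w] coordinates, in random position because of
    [s], and the starting vertex [d] only shifts the base point. *)
Lemma sum_block_persp M k r (d w : cube M) : (0 < k)%N -> (k * M <= n)%N ->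
  \sum_(s : {perm 'I_n}) \sum_(e : cube n)
    persp p (k%:R * (cwt w)%:R) (block_metric k r s e d (cxor d w)) =
  energyk r (k * cwt w).
Proof.
move=> k0 kM.
pose H s e := persp p (k%:R * (cwt w)%:R) (r e (cxor e (cperm s (cblk n k w)))).
transitivity (\sum_(s : {perm 'I_n}) \sum_(e : cube n)
    H s (cxor e (cperm s (cblk n k d)))).
  do 2!apply: eq_bigr => ? _.
  by rewrite /block_metric cblk_cxor cperm_cxor cxorA.
have wM : (cwt w <= M)%N by rewrite -[leqRHS](card_ord M) max_card.
rewrite sum_shift /energyk (energy_wt r _ (cblk n k w)); last first.
  by rewrite cwt_cblk // cwt_cini // (leq_trans _ kM) // leq_mul.
by rewrite /energy cwt_cblk // natrM.
Qed.

(** The two legs flip [k * cwt w] and [k * (M - cwt w)] coordinates; by [energykM] they cost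
    together at most [M] blocks. *)
Lemma sum_block_defect M k r (d w : cube M) : pmetric r -> (0 < k)%N ->
  (k * M <= n)%N ->
  \sum_(s : {perm 'I_n}) \sum_(e : cube n)
    defect p k%:R (block_metric k r s e) d w <=
  M%:R * energyk r k - energyk r (k * M).
Proof.
move=> rP k0 kM; rewrite /defect.
under eq_bigr do rewrite sumrB big_split.
rewrite sumrB big_split /= sum_block_persp //.
have cw := cwt_neg M w.
have -> : \sum_(s : {perm 'I_n}) \sum_(e : cube n) persp p (k%:R * (cwt (cneg w))%:R)
    (block_metric k r s e (cxor d w) (cneg d)) = energyk r (k * cwt (cneg w)).
  rewrite -(sum_block_persp _ _ _ (cxor d w)) //; do 2!apply: eq_bigr => ? _.
  by rewrite -cxorA cxor_cneg cxorvv -cneg_cxor.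
have -> : \sum_(s : {perm 'I_n}) \sum_(e : cube n) persp p (k%:R * M%:R)
    (block_metric k r s e d (cneg d)) = energyk r (k * M).
  rewrite -[in RHS](cwt_one M) -(sum_block_persp _ _ _ d) //.
  by do 2!apply: eq_bigr => ? _; rewrite -cneg_cxor cwt_one.
have -> : M%:R = (cwt w)%:R + (cwt (cneg w))%:R :> R by rewrite -natrD cw.
rewrite lerD2r mulrDl.
by apply: lerD; apply: energykM => //; apply: leq_trans kM; rewrite leq_mul2l; lia.
Qed.

(** First-moment argument: if the inequality failed for all [s] and [e], summing would contradict
    the hypothesis. The cardinal counts the pairs [(d, w)]; [c] controls the ratio of the two
    distances and [K] penalizes defects. *)
Lemma exists_good_block M k rX rY (c K : R) : pmetric rX -> pmetric rY ->
  (0 < k)%N -> (k * M <= n)%N -> 0 <= K ->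
  c * energyk rX (k * M) + K * #|{: cube M * cube M}|%:R *
    ((M%:R * energyk rX k - energyk rX (k * M)) +
     (M%:R * energyk rY k - energyk rY (k * M))) < energyk rY (k * M) ->
  exists s e,
    let bX := @block_metric M k rX s e in let bY := @block_metric M k rY s e in
    c * persp p (k%:R * M%:R) (bX (czero M) (cneg (czero M))) +
    K * \sum_(dw : cube M * cube M)
          (defect p k%:R bX dw.1 dw.2 + defect p k%:R bY dw.1 dw.2) <
    persp p (k%:R * M%:R) (bY (czero M) (cneg (czero M))).
Proof.
move=> rXP rYP k0 kM K0 h; apply: contrapT => hno; move: h; apply/negP; rewrite -leNgt.
have tot r : energyk r (k * M) = \sum_(s : {perm 'I_n}) \sum_(e : cube n)
    persp p (k%:R * M%:R) (block_metric k r s e (czero M) (cneg (czero M))).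
  rewrite -[in LHS](cwt_one M) -(sum_block_persp _ _ _ (czero M)) //.
  by do 2!apply: eq_bigr => ? _; rewrite -cneg_cxor cwt_one.
have lower : energyk rY (k * M) <= \sum_(s : {perm 'I_n}) \sum_(e : cube n)
   (c * persp p (k%:R * M%:R) (block_metric k rX s e (czero M) (cneg (czero M))) +
    K * \sum_(dw : cube M * cube M)
      (defect p k%:R (block_metric k rX s e) dw.1 dw.2 +
       defect p k%:R (block_metric k rY s e) dw.1 dw.2)).
  rewrite tot; apply: ler_sum => s _; apply: ler_sum => e _.
  by rewrite leNgt; apply/negP => hlt; apply: hno; exists s, e.
apply: le_trans lower _.
have lin (A B : {perm 'I_n} -> cube n -> R) : \sum_s \sum_e (c * A s e + K * B s e) =
    c * (\sum_s \sum_e A s e) + K * (\sum_s \sum_e B s e).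
  rewrite !mulr_sumr -big_split; apply: eq_bigr => s _.
  by rewrite !mulr_sumr -big_split.
rewrite lin -tot lerD2l -mulrA ler_wpM2l //.
under eq_bigr do rewrite exchange_big /=.
rewrite exchange_big /=.
rewrite mulr_natl -sumr_const; apply: ler_sum => -[d w] _ /=.
under eq_bigr do rewrite big_split.
by rewrite big_split lerD //; exact: sum_block_defect.
Qed.

End Energy.

(** * Choosing the scale *)

Section Blocks.
Context {R : realType}.

(** Otherwise [J] drops of at least [eta] would telescope to at least [J * eta]. *)
Lemma telescope_small (S : nat -> R) (J : nat) (eta : R) :
  S 0%N - S J < J%:R * eta -> exists2 j, (j < J)%N & S j - S j.+1 < eta.
Proof.
move=> h; apply: contrapT => hno.
have : forall i, (i <= J)%N -> i%:R * eta <= S 0%N - S i.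
  elim=> [_|i IH iJ]; first by rewrite mul0r subrr.
  have : eta <= S i - S i.+1.
    by rewrite leNgt; apply/negP => hlt; apply: hno; exists i.
  have := IH (ltnW iJ); rewrite -[i.+1]addn1 natrD mulrDl mul1r; lra.
by move=> /(_ J (leqnn J)); lra.
Qed.

Section Scale.
Variables (p L T : R) (n M J : nat) (rX rY : cube n -> cube n -> R).
Hypotheses (p1 : 1 < p) (L0 : 0 <= L) (T0 : 0 < T) (M0 : (0 < M)%N).
Hypotheses (rXP : pmetric rX) (rYP : pmetric rY).
Hypothesis (rYX : forall e d, rY e d <= L * rX e d).
Hypothesis MJn : (M ^ J <= n)%N.
Hypothesis nbig : 2 * ((M ^ J)%:R * L `^ p) <= T * n%:R.
Hypothesis hT : T * (n%:R * energyk p n rX 1) < energyk p n rY n.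

Let MJ j : (j <= J)%N -> (M ^ j <= M ^ J)%N.
Proof. by move=> jJ; rewrite leq_pexp2l. Qed.

Let n0 : (0 < n)%N.
Proof. by apply: leq_trans MJn; rewrite expn_gt0 M0. Qed.

Let nR : 0 < n%:R :> R. Proof. by rewrite ltr0n. Qed.

Let MjR j : 0 < (M ^ j)%:R :> R.
Proof. by rewrite ltr0n expn_gt0 M0. Qed.

Let EYX k : energyk p n rY k <= L `^ p * energyk p n rX k.
Proof. exact: le_energy. Qed.

(** If it vanished, so would the edge energy of [rY] by the Lipschitz bound, hence by subadditivity
    its full energy, against the strict [hT]. *)
Lemma energyk1_gt0 : 0 < energyk p n rX 1.
Proof.
have h1 : energyk p n rY n <= n%:R * energyk p n rY 1.
  by have := energykM p n p1 rY 1 n rYP; rewrite mul1n; apply.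
have := energy_ge0 p n rX (cini n 1); rewrite -/(energyk _ _ _ _).
rewrite le_eqVlt => /orP[/eqP E0|//].
have := EYX 1; rewrite -E0 mulr0 => E1.
have : n%:R * energyk p n rY 1 <= 0 by rewrite mulr_ge0_le0 // ltW.
by move: hT; rewrite -E0 !mulr0; lra.
Qed.

Let G j := energyk p n rX (M ^ j) / (M ^ j)%:R.
Let H j := energyk p n rY (M ^ j) / (M ^ j)%:R.
Let G0 := energyk p n rX 1.

Lemma upper_scale j : (j <= J)%N -> G j <= G0.
Proof.
move=> jJ; rewrite /G ler_pdivrMr // mulrC.
have := energykM p n p1 rX 1 (M ^ j) rXP; rewrite mul1n; apply.
exact: leq_trans (MJ _ jJ) MJn.
Qed.

(** Cut [n] into [q] pieces of size [k] and a remainder [l < k]. The remainder costs at most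
    [k * L ^ p * G0], which [nbig] bounds by half of the lower bound [hT]; hence [T / 2]. *)
Lemma lower_scale j : (j <= J)%N -> T / 2 * G0 <= H j.
Proof.
move=> jJ; set k := (M ^ j)%N.
have kn : (k <= n)%N := leq_trans (MJ _ jJ) MJn.
have k0 : (0 < k)%N by rewrite expn_gt0 M0.
have G0p : 0 < G0 := energyk1_gt0.
have kR : 0 < k%:R :> R by rewrite ltr0n.
set q := (n %/ k)%N; set l := (n %% k)%N.
(* The factor 1 puts both summands in the form expected by [energykM]. *)
have nE : n = (k * q + 1 * l)%N by rewrite mul1n mulnC; exact: divn_eq.
have h1 : energyk p n rY n <= q%:R * energyk p n rY k + l%:R * energyk p n rY 1.
  rewrite [X in energyk p n rY X <= _]nE.
  apply: le_trans (energykD p n p1 rY _ _ rYP _) _; first by rewrite -nE.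
  by apply: lerD; apply: energykM => //; rewrite [leqRHS]nE ?leq_addr ?leq_addl.
have h2 : l%:R * energyk p n rY 1 <= k%:R * (L `^ p * G0).
  apply: ler_pM => //; first exact: energy_ge0.
  - by rewrite ler_nat ltnW // ltn_mod.
have h3 : q%:R * energyk p n rY k <= n%:R * H j.
  have -> : energyk p n rY k = k%:R * H j by rewrite /H mulrC divfK // gt_eqF.
  rewrite mulrA -natrM ler_wpM2r ?divr_ge0 ?energy_ge0 //.
  by rewrite ler_nat mulnC [leqRHS]nE leq_addr.
have h4 : k%:R * L `^ p <= n%:R * (T / 2).
  have : k%:R * L `^ p <= (M ^ J)%:R * L `^ p.
    by rewrite ler_wpM2r ?powR_ge0 // ler_nat MJ.
  by move: nbig; set Q := (M ^ J)%:R * _ => h h'; lra.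
have h5 : k%:R * (L `^ p * G0) <= n%:R * (T / 2) * G0.
  by rewrite mulrA ler_wpM2r // ltW.
rewrite -(ler_pM2l nR).
have hT' : T * (n%:R * G0) < energyk p n rY n := hT.
lra.
Qed.

Lemma good_scale (eta : R) : 0 < eta -> 1 + L `^ p < J%:R * eta ->
  exists2 j, (j < J)%N &
    [/\ G j.+1 <= G0, T / 2 * G0 <= H j.+1 &
        (G j - G j.+1) + (H j - H j.+1) < eta * G0].
Proof.
move=> eta0 hJ; have G0p : 0 < G0 := energyk1_gt0.
(* Telescoping the sum [G + H], which starts at most at [(1 + L ^ p) * G0] and stays nonnegative,
   finds one scale good for both metrics. *)
have [|j jJ hj] := telescope_small (fun j => G j + H j) J (eta * G0).
  have g0 : G 0 = G0 by rewrite /G expn0 divr1.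
  have h0 : H 0 <= L `^ p * G0 by rewrite /H expn0 divr1 EYX.
  have gJ : 0 <= G J by rewrite divr_ge0 // energy_ge0.
  have hJ0 : 0 <= H J by rewrite divr_ge0 // energy_ge0.
  have : (1 + L `^ p) * G0 < J%:R * eta * G0 by rewrite ltr_pM2r.
  lra.
by exists j => //; split; [exact: upper_scale|exact: lower_scale|lra].
Qed.

End Scale.

(** Budget: the ratio term takes [T / 4] and the defects [T / 8], within the available [T / 2]. *)
Lemma scale_arith (T x y g z : R) : 0 < T -> 0 < g ->
  x <= g -> T / 2 * g <= y -> z < T / 8 * g -> T / 4 * x + z < y.
Proof.
move=> T0 g0 xg gy zg.
have : T / 4 * x <= T / 4 * g by rewrite ler_pM2l //; lra.
have : 0 < T * g by rewrite mulr_gt0.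
lra.
Qed.

Lemma near_isometric_blocks (p L T e : R) (M : nat) :
  1 < p -> 0 <= L -> 0 < T -> (0 < M)%N -> 0 < e -> e < 1 ->
  exists N : nat, forall n, (N <= n)%N -> forall rX rY : cube n -> cube n -> R,
    pmetric rX -> pmetric rY -> (forall e d, rY e d <= L * rX e d) ->
    T * (n%:R * energyk p n rX 1) < energyk p n rY n ->
    exists (g : cube M -> cube n) (a b : R),
      [/\ 0 < a, 0 < b, T / 4 * a `^ p <= b `^ p &
       forall d w : cube M,
        (1 - e) ^+ 2 * ((cwt w)%:R / M%:R * a) <= rX (g d) (g (cxor d w))
          <= (1 + e) ^+ 2 * ((cwt w)%:R / M%:R * a) /\
        (1 - e) ^+ 2 * ((cwt w)%:R / M%:R * b) <= rY (g d) (g (cxor d w))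
          <= (1 + e) ^+ 2 * ((cwt w)%:R / M%:R * b)].
Proof.
move=> p1 L0 T0 M0 e0 e1.
have [k0 k0p stab] := cube_stability p e M p1 M0 e0 e1.
have Lp0 : 0 <= L `^ p := powR_ge0 _ _.
(* The good block will satisfy [K * Sm <= B] and [B <= L ^ p * A], so this [K] bounds each defect
   both by [k0 * A] and by [k0 * B]. *)
pose K := (1 + L `^ p) / k0.
have Kp : 0 < K by rewrite divr_gt0 //; lra.
pose C : R := #|{: cube M * cube M}|%:R.
have Cp : 0 < C by rewrite ltr0n; apply/card_gt0P; exists (czero M, czero M).
have KCp : 0 < K * C by rewrite mulr_gt0.
(* Makes the total penalty [K * C * eta] equal to the share [T / 8] of [scale_arith]. *)
pose eta := T / (8 * (K * C)).
have etap : 0 < eta by rewrite divr_gt0 //; lra.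
have etaE : K * C * eta = T / 8 by rewrite /eta; field; rewrite !gt_eqF.
have [J hJ] : exists J : nat, 1 + L `^ p < J%:R * eta.
  exists (Num.bound ((1 + L `^ p) / eta)).
  by rewrite -ltr_pdivrMr // archi_boundP // divr_ge0 ?(ltW etap) //; lra.
have [N1 hN1] : exists N1 : nat, 2 * ((M ^ J)%:R * L `^ p) / T <= N1%:R.
  exists (Num.bound (2 * ((M ^ J)%:R * L `^ p) / T)).
  by apply/ltW/archi_boundP; rewrite divr_ge0 ?(ltW T0) // !mulr_ge0.
(* [M ^ J] makes the blocks fit into [n], and [N1] makes the remainder in [lower_scale]
   negligible. *)
exists (N1 + M ^ J)%N => n nN rX rY rXP rYP rYX hT.
have MJn : (M ^ J <= n)%N by apply: leq_trans nN; rewrite leq_addl.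
have nbig : 2 * ((M ^ J)%:R * L `^ p) <= T * n%:R.
  rewrite [leRHS]mulrC -ler_pdivrMr //.
  by apply: le_trans hN1 _; rewrite ler_nat (leq_trans _ nN) // leq_addr.
have G0p : 0 < energyk p n rX 1 by apply: (energyk1_gt0 p L T n rX rY).
have [j jJ [hG hH hS]] :=
  good_scale p L T n M J rX rY p1 L0 M0 rXP rYP rYX MJn nbig hT eta etap hJ.
set G0 := energyk p n rX 1 in G0p hG hH hS.
set k := (M ^ j)%N in hS.
have kp : (0 < k)%N by rewrite expn_gt0 M0.
have kMn : (k * M <= n)%N.
  by apply: leq_trans MJn; rewrite mulnC -expnS leq_pexp2l.
have mE : (M ^ j.+1)%N = (k * M)%N by rewrite expnS mulnC.
rewrite mE in hG hH hS; have kR : 0 < k%:R :> R by rewrite ltr0n.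
have mp : 0 < (k * M)%:R :> R by rewrite ltr0n muln_gt0 kp.
have mkM : (k * M)%:R = k%:R * M%:R :> R by rewrite natrM.
move: (k * M)%:R mp mkM hG hH hS => m mp mkM hG hH hS.
have [|s [w0 hgood]] :=
  exists_good_block p n p1 M k rX rY (T / 4) K rXP rYP kp kMn (ltW Kp).
  set EXm := energyk p n rX (k * M) in hG hS *.
  set EYm := energyk p n rY (k * M) in hH hS *.
  set EXk := energyk p n rX k in hS *; set EYk := energyk p n rY k in hS *.
  rewrite (ler_pdivrMr _ _ mp) in hG; rewrite (ler_pdivlMr _ _ mp) in hH.
  have alg (x x' y y' u v : R) : 0 < u -> 0 < v ->
      (v * x - x' + (v * y - y')) / (u * v) =
      x / u - x' / (u * v) + (y / u - y' / (u * v)).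
    by move=> u0 v0; field; rewrite !gt_eqF.
  have hS' : (M%:R * EXk - EXm) + (M%:R * EYk - EYm) < eta * G0 * m.
    rewrite -(ltr_pdivrMr _ _ mp); apply: le_lt_trans hS.
    rewrite le_eqVlt; apply/orP; left.
    by apply/eqP; rewrite mkM alg // ltr0n.
  rewrite -/C; apply: (scale_arith T _ _ (G0 * m)) => //.
  - by rewrite mulr_gt0.
  - by rewrite mulrA.
  - have -> : T / 8 * (G0 * m) = K * C * (eta * G0 * m) by rewrite -etaE; ring.
    by rewrite ltr_pM2l.
pose bX := @block_metric R n M k rX s w0; pose bY := @block_metric R n M k rY s w0.
have bXP : pmetric bX by exact: block_pmetric.
have bYP : pmetric bY by exact: block_pmetric.
move: hgood => /=; rewrite -/bX -/bY.
pose a := bX (czero M) (cneg (czero M)); pose b := bY (czero M) (cneg (czero M)).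
rewrite -/a -/b; set Sm := \sum_dw _ => hgood.
have a0 : 0 <= a := pmetric_ge0 _ _ bXP _ _.
have b0 : 0 <= b := pmetric_ge0 _ _ bYP _ _.
have kM0 : 0 < k%:R * M%:R :> R by rewrite -mkM.
have dX d w : 0 <= defect p k%:R bX d w by exact: defect_ge0.
have dY d w : 0 <= defect p k%:R bY d w by exact: defect_ge0.
set A := persp p (k%:R * M%:R) a in hgood; set B := persp p (k%:R * M%:R) b in hgood.
have A0 : 0 <= A by apply: persp_ge0; exact: ltW.
have Sm0 : 0 <= Sm by apply: sumr_ge0 => dw _; rewrite addr_ge0.
have dSm d w : defect p k%:R bX d w + defect p k%:R bY d w <= Sm.
  by rewrite /Sm (bigD1 (d, w)) //= lerDl sumr_ge0 // => dw _; rewrite addr_ge0.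
have KSm : 0 <= K * Sm by rewrite mulr_ge0 // ltW.
have TA : 0 <= T / 4 * A by rewrite mulr_ge0 // divr_ge0 // ltW.
have B0 : 0 < B by apply: le_lt_trans hgood; rewrite addr_ge0.
have BA : B <= L `^ p * A.
  rewrite -perspMr // ?(ltW kM0) //; apply: le_persp; rewrite ?(ltW kM0) //.
  exact: rYX.
have KSmB : K * Sm <= B by apply/ltW/(le_lt_trans _ hgood); rewrite lerDr.
have TAB : T / 4 * A <= B by apply/ltW/(le_lt_trans _ hgood); rewrite lerDl.
have Ap : 0 < A.
  rewrite lt_def A0 andbT; by apply/eqP => AE; move: BA; rewrite AE mulr0 leNgt B0.
have pos t : 0 <= t -> 0 < persp p (k%:R * M%:R) t -> 0 < t.
  by rewrite le_eqVlt => /orP[/eqP <-|//]; rewrite persp0 // ltxx.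
have ap := pos a a0 Ap; have bp := pos b b0 B0.
have Kk0 : K * k0 = 1 + L `^ p by rewrite /K divfK // gt_eqF.
have defX d w : defect p k%:R bX d w <= k0 * A.
  rewrite -(ler_pM2l Kp) mulrA Kk0.
  apply: (@le_trans _ _ (K * Sm)).
    by rewrite ler_pM2l //; apply: le_trans (dSm d w); rewrite lerDl.
  by rewrite mulrDl mul1r -[leLHS]add0r lerD // (le_trans KSmB).
have defY d w : defect p k%:R bY d w <= k0 * B.
  rewrite -(ler_pM2l Kp) mulrA Kk0.
  apply: (@le_trans _ _ (K * Sm)).
    by rewrite ler_pM2l //; apply: le_trans (dSm d w); rewrite lerDr.
  by rewrite mulrDl mul1r (le_trans KSmB) // lerDl mulr_ge0 // ltW.
exists (fun d => cxor w0 (cperm s (cblk n k d))), a, b; split => //.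
  have sc t : 0 <= t -> persp p (k%:R * M%:R) t = t `^ p * persp p (k%:R * M%:R) 1.
    by move=> t0; rewrite -[t in LHS]mulr1 perspMr // ltW.
  have P1 : 0 < persp p (k%:R * M%:R) 1.
    by rewrite mulr_gt0 // powR_gt0 // divr_gt0.
  by rewrite -(ler_pM2r P1) -[T / 4 * _ * _]mulrA -!sc.
move=> d w; split.
  by apply: (stab k%:R bX a).
by apply: (stab k%:R bY b).
Qed.

End Blocks.

(** * The coefficients [a_n] and [b_pn] *)

Section LimSup.
Context {R : realType}.

(** Boundedness identifies the limsup with the infimum of the tail suprema; half of it serves as
    [th], which leaves a strict inequality in each tail. *)
Lemma limn_sup_gt0P (u : nat -> R) (B : R) : (forall n, 0 <= u n <= B) ->
  0 < limn_sup u <->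
  exists2 th : R, 0 < th & forall N, exists2 n, (N <= n)%N & th < u n.
Proof.
move=> uB.
have ub N : has_ubound (sdrop u N).
  by exists B => _ [k _ <-]; case/andP: (uB k).
have ne N : sdrop u N !=set0 by exists (u N), N => //=.
have bu : bounded_fun (u : nat -> R^o).
  exists B; split; first exact: num_real.
  move=> x Bx n _ /=; case/andP: (uB n) => u0 uBn.
  by rewrite ger0_norm // (le_trans uBn) // ltW.
have sups0 N : 0 <= sups u N.
  by apply: le_trans (ub_le_sup (ub N) _); [|exists N => //=]; case/andP: (uB N).
rewrite limn_supE //; split=> [h|[th th0 hth]].
  exists (inf (range (sups u)) / 2); first by rewrite divr_gt0.
  move=> N; have hN : inf (range (sups u)) / 2 < sup (sdrop u N).
    apply: (@lt_le_trans _ _ (inf (range (sups u)))); first by lra.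
    apply: ge_inf; first by exists 0 => _ [k _ <-].
    by exists N.
  have [_ [k kN <-] hk] := sup_gt (ne N) hN.
  by exists k.
apply: (lt_le_trans th0); apply: lb_le_inf; first by exists (sups u 0%N), 0%N.
move=> _ [N _ <-]; have [n Nn hn] := hth N.
by apply: le_trans (ltW hn) _; apply: ub_le_sup => //; exists n.
Qed.

End LimSup.

Section Coefficients.
Context {R : realType}.
Variables (lam : R) (Fam : set (metricMap R)).
Hypotheses (lam0 : 0 < lam).
Hypothesis FamL : forall m, Fam m -> is_lipschitz_map lam m.

Lemma mdist_pmetric (n : nat) (X : metricSpace R) (f : cube n -> X) :
  pmetric (fun e d => mdist (f e) (f d)).
Proof.
split=> *; [exact/mdist0|exact: mdistC|exact: mdist_tri].
Qed.

Lemma mspace_dist_ge0 (X : metricSpace R) (x y : X) : 0 <= mdist x y.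
Proof.
by have := mdist_tri x y x; rewrite (mdistC y x) (_ : mdist x x = 0); [lra|exact/mdist0].
Qed.

Lemma cube_card_gt0 n : 0 < #|{: cube n}|%:R :> R.
Proof. by rewrite ltr0n; apply/card_gt0P; exists (czero n). Qed.

Lemma cubeE_le n (g : cube n -> R) (c : R) : (forall e, g e <= c) -> cubeE g <= c.
Proof.
move=> h; rewrite /cubeE ler_pdivrMr ?cube_card_gt0 // mulr_natr -sumr_const.
exact: ler_sum.
Qed.

Lemma cubeE_ge n (g : cube n -> R) (c : R) : (forall e, c <= g e) -> c <= cubeE g.
Proof.
move=> h; rewrite /cubeE ler_pdivlMr ?cube_card_gt0 // mulr_natr -sumr_const.
exact: ler_sum.
Qed.

Lemma lipCube_ge n (X : metricSpace R) (f : cube n -> X) e d :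
  mdist (f e) (f d) / hamming R e d <= lipCube f.
Proof.
apply: le_trans (le_bigmax _ (fun e => \big[Num.max/0]_(d : cube n)
     (mdist (f e) (f d) / hamming R e d)) e).
exact: (le_bigmax _ (fun d => mdist (f e) (f d) / hamming R e d)).
Qed.

Lemma lipCube_ge0 n (X : metricSpace R) (f : cube n -> X) : 0 <= lipCube f.
Proof. exact: bigmax_ge_id. Qed.

Lemma lipCube_le n (X : metricSpace R) (f : cube n -> X) (c : R) : 0 <= c ->
  (forall e d, mdist (f e) (f d) / hamming R e d <= c) -> lipCube f <= c.
Proof. by move=> c0 h; do 2!apply: bigmax_le => // ? _. Qed.

Lemma mdist_antipode n (X : metricSpace R) (f : cube n -> X) e :
  mdist (f e) (f (cneg e)) <= lipCube f.
Proof.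
have [n0|n0] := posnP n; last first.
  by have := lipCube_ge n X f e (cneg e); rewrite hamming_neg // divr1.
(* On the 0-cube the antipode of a point is the point itself. *)
have -> : cneg e = e by apply/ffunP => -[j jn]; exfalso; move: jn; rewrite n0.
by rewrite (_ : mdist _ _ = 0) ?lipCube_ge0 //; exact/mdist0.
Qed.

Lemma mdist_flip n (X : metricSpace R) (f : cube n -> X) e i :
  mdist (f e) (f (cflip i e)) <= lipCube f / n%:R.
Proof.
have n0 : (0 < n)%N by exact: leq_ltn_trans (ltn_ord i).
have := lipCube_ge n X f e (cflip i e); rewrite hammingE.
have -> : cwt (cxor e (cflip i e)) = 1%N.
  rewrite -(card1 i); apply: eq_card => j; rewrite !inE !ffunE.
  by case: eqP; rewrite ?addbN addbb.
by rewrite invfM invr1 invrK mul1r ler_pdivlMr // ltr0n.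
Qed.

(** [Sa] and [Sb] repeat the sets under the infima in [a_n] and [b_pn], so that facts about them
    apply by conversion. *)
Let Sa n := [set a : R | 0 < a /\
    forall m, Fam m -> forall f : cube n -> msrc m,
      cubeE (fun e => mdist (mfun m (f e)) (mfun m (f (cneg e))))
        <= a * lipCube f].

Let Sb p n := [set b : R | 0 < b /\
    forall m, Fam m -> forall f : cube n -> msrc m,
      cubeE (fun e => mdist (mfun m (f e)) (mfun m (f (cneg e))) `^ p)
        <= b `^ p * n%:R `^ (p - 1) *
           \sum_(i < n) cubeE (fun e => mdist (f e) (f (cflip i e)) `^ p)].

Let Sa_lb n : has_lbound (Sa n). Proof. by exists 0 => a [/ltW]. Qed.
Let Sb_lb p n : has_lbound (Sb p n). Proof. by exists 0 => a [/ltW]. Qed.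

(** Besides the upper bound, this supplies the nonemptiness that any lower bound on the infimum
    needs. *)
Lemma Sa_lam n : Sa n lam.
Proof.
split=> // m Fm f; apply: cubeE_le => e.
by apply: le_trans (FamL _ Fm _ _) _; rewrite ler_pM2l // mdist_antipode.
Qed.

(* Multiplying by [n! 2^n n^(1-p)] turns the inequality defining [b_pn] into one between energies. *)
Lemma b_ineq_energy p n (m : metricMap R) (f : cube n -> msrc m) (b : R) :
  1 < p -> (0 < n)%N ->
  (cubeE (fun e => mdist (mfun m (f e)) (mfun m (f (cneg e))) `^ p)
    <= b `^ p * n%:R `^ (p - 1) *
       \sum_(i < n) cubeE (fun e => mdist (f e) (f (cflip i e)) `^ p)) =
  (energyk p n (fun e d => mdist (mfun m (f e)) (mfun m (f d))) n <=
   b `^ p * (n%:R * energyk p n (fun e d => mdist (f e) (f d)) 1)).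
Proof.
move=> p1 n0; rewrite energykn // energyk1 //.
have nR : 0 < n%:R :> R by rewrite ltr0n.
set N := #|{perm 'I_n}|%:R; have N0 : 0 < N :> R.
  by rewrite ltr0n; apply/card_gt0P; exists 1%g.
set nu := n%:R `^ (p - 1); have nu0 : 0 < nu by rewrite powR_gt0.
have np : n%:R `^ p = n%:R * nu.
  rewrite -{2}[n%:R](powRr1 (ltW nR)) -powRD ?subrKC //.
  by apply/implyP => _; rewrite gt_eqF.
have pe x : 0 <= x -> persp p n%:R x = x `^ p / nu.
  move=> x0; rewrite /persp; have -> : x `^ p = n%:R `^ p * (x / n%:R) `^ p.
    by rewrite -powRM ?divr_ge0 // mulrC divfK // gt_eqF.
  by rewrite np; field; rewrite gt_eqF.
under [X in _ = (N * X <= _)]eq_bigr do rewrite pe ?mspace_dist_ge0 //.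
under [X in _ = (_ <= _ * (N * X))]eq_bigr do
  under eq_bigr do rewrite /persp mul1r divr1.
rewrite -mulr_suml /cubeE -mulr_suml.
set U := \sum_e _; set V := \sum_i _; set Q := #|_|%:R.
have Q0 : 0 < Q :> R := cube_card_gt0 n.
transitivity (U <= b `^ p * nu * V); first by rewrite mulrA ler_pM2r // invr_gt0.
by rewrite [b `^ p * (N * V)]mulrCA ler_pM2l // ler_pdivrMr // mulrAC.
Qed.

(** In energies this is subadditivity along the [n] edges of an antipodal path, followed by the
    Lipschitz bound. *)
Lemma Sb_lam p n : 1 < p -> Sb p n lam.
Proof.
move=> p1; split=> // m Fm f; have [n0|n0] := posnP n.
  apply: (@le_trans _ _ 0).
    apply: cubeE_le => e.
    have := mdist_antipode n (mtgt m) (fun e => mfun m (f e)) e.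
    have -> : cneg e = e by apply/ffunP => -[j jn]; exfalso; move: jn; rewrite n0.
    rewrite (_ : mdist _ _ = 0) => [_|]; last exact/mdist0.
    by rewrite powR0 // gt_eqF // (lt_trans _ p1).
  rewrite mulr_ge0 ?mulr_ge0 ?powR_ge0 // sumr_ge0 // => i _.
  by apply: cubeE_ge => e; exact: powR_ge0.
rewrite b_ineq_energy //.
set rX := fun e d : cube n => mdist (f e) (f d).
set rY := fun e d : cube n => mdist (mfun m (f e)) (mfun m (f d)).
have rXP : pmetric rX by exact: mdist_pmetric.
have rYP : pmetric rY by exact: (mdist_pmetric n _ (fun e => mfun m (f e))).
have := energykM p n p1 rY 1 n rYP; rewrite mul1n => /(_ (leqnn n)) h.
apply: le_trans h _; rewrite mulrCA ler_wpM2l //.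
by apply: le_energy => //; [exact: ltW|move=> e d; exact: FamL].
Qed.

Lemma a_n_bounds n : 0 <= a_n Fam n <= lam.
Proof.
apply/andP; split; last by apply: ge_inf; [exact: Sa_lb|exact: Sa_lam].
by apply: lb_le_inf; [exists lam; exact: Sa_lam|move=> a [/ltW]].
Qed.

Lemma b_pn_bounds p n : 1 < p -> 0 <= b_pn Fam p n <= lam.
Proof.
move=> p1; apply/andP; split; last by apply: ge_inf; [exact: Sb_lb|exact: Sb_lam].
by apply: lb_le_inf; [exists lam; exact: Sb_lam|move=> a [/ltW]].
Qed.

(** Jensen bounds the left side from below. On the right each edge has length at most
    [lipCube f / n], and the powers of [n] cancel to leave [(b * lipCube f) ^ p]. *)
Lemma a_n_le_b_pn p n : 1 < p -> a_n Fam n <= b_pn Fam p n.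
Proof.
move=> p1; apply: lb_le_inf; first by exists lam; exact: Sb_lam.
move=> b [b0 hb]; apply: ge_inf; first exact: Sa_lb.
split=> // m Fm f; have := hb m Fm f.
set rho := fun e => mdist (mfun m (f e)) (mfun m (f (cneg e))) => h.
have p0 : 0 <= p by rewrite ltW // (lt_trans _ p1).
have [n0|n0] := posnP n.
  apply: (@le_trans _ _ 0); last by rewrite mulr_ge0 ?lipCube_ge0 // ltW.
  apply: cubeE_le => e; rewrite /rho.
  have -> : cneg e = e by apply/ffunP => -[j jn]; exfalso; move: jn; rewrite n0.
  by rewrite (_ : mdist _ _ = 0) //; exact/mdist0.
have nR : 0 < n%:R :> R by rewrite ltr0n.
have l0 := lipCube_ge0 n _ f.
have E0 : 0 <= cubeE rho by apply: cubeE_ge => e; exact: mspace_dist_ge0.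
have jen : cubeE rho `^ p <= cubeE (fun e => rho e `^ p).
  apply: jensen_powR => //; first by move=> e; exact: mspace_dist_ge0.
  by apply/card_gt0P; exists (czero n).
have bound : cubeE (fun e => rho e `^ p) <= (b * lipCube f) `^ p.
  apply: le_trans h _; rewrite powRM ?(ltW b0) // -mulrA ler_wpM2l ?powR_ge0 //.
  have : \sum_(i < n) cubeE (fun e => mdist (f e) (f (cflip i e)) `^ p) <=
      n%:R * (lipCube f / n%:R) `^ p.
    rewrite mulr_natl -[X in _ *+ X](card_ord n) -sumr_const.
    apply: ler_sum => i _; apply: cubeE_le => e.
    apply: ge0_ler_powR; rewrite ?nnegrE ?mspace_dist_ge0 ?divr_ge0 //.
    exact: mdist_flip.
  move=> /(ler_wpM2l (powR_ge0 n%:R (p - 1))) h2; apply: le_trans h2 _.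
  have np : n%:R `^ (p - 1) * n%:R = n%:R `^ p :> R.
    rewrite -[X in _ * X](powRr1 (ltW nR)) -powRD ?subrK //.
    by apply/implyP => _; rewrite gt_eqF.
  by rewrite mulrA np -powRM ?divr_ge0 ?(ltW nR) // mulrC divfK ?gt_eqF.
rewrite leNgt; apply/negP => hlt.
have pp : 0 < p by rewrite (lt_trans _ p1).
have : (b * lipCube f) `^ p < cubeE rho `^ p.
  by apply: (gt0_ltr_powR pp) => //; rewrite nnegrE ?mulr_ge0 ?(ltW b0).
by move=> hlt'; have := le_lt_trans (le_trans jen bound) hlt'; rewrite ltxx.
Qed.

(** Antipodes are at Hamming distance 1, so an admissible [x] satisfies
    [b / D <= x * lipCube f <= x * a * D], whence [x >= c / D ^ 2]. *)
Lemma crude_limsup : crudely_factors Fam -> 0 < limn_sup (a_n Fam).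
Proof.
case=> c [D [c0 [D0 h]]]; apply/(limn_sup_gt0P _ lam a_n_bounds).
exists (c / (D * D) / 2); first by rewrite !divr_gt0 ?mulr_gt0.
move=> N; exists N.+1 => //.
have cD : 0 < c / (D * D) by rewrite divr_gt0 ?mulr_gt0.
apply: (@lt_le_trans _ _ (c / (D * D))); first by rewrite ltr_pdivrMr // ltr_pMr //; lra.
apply: lb_le_inf; first by exists lam; exact: Sa_lam.
move=> x [x0 hx]; have [m [Fm [f [a [b [a0 [b0 [acb fac]]]]]]]] := h N.+1 isT.
have h1 : b / D <= x * lipCube f.
  apply: le_trans (hx m Fm f); apply: cubeE_ge => e.
  by have [_ [_ [+ _]]] := fac e (cneg e); rewrite hamming_neg // mulr1.
have h2 : lipCube f <= a * D.
  apply: lipCube_le; first by rewrite mulr_ge0 // ltW.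
  move=> e d; have [_ [+ _]] := fac e d.
  have [->|hn] := eqVneq (hamming R e d) 0.
    by rewrite invr0 !mulr0 mulr_ge0 // ltW.
  rewrite ler_pdivrMr // lt_def hn /= hammingE divr_ge0 //.
rewrite ler_pdivrMr ?mulr_gt0 // -(ler_pM2l a0).
have h3 : b <= x * (a * D) * D.
  by rewrite -ler_pdivrMr //; apply: le_trans h1 _; rewrite ler_pM2l.
apply: le_trans acb _; apply: le_trans h3 _; rewrite le_eqVlt; apply/orP; left.
by apply/eqP; ring.
Qed.

Lemma limsup_a_b p : 1 < p ->
  0 < limn_sup (a_n Fam) -> 0 < limn_sup (b_pn Fam p).
Proof.
move=> p1 /(limn_sup_gt0P _ lam a_n_bounds) [th th0 h].
apply/(limn_sup_gt0P _ lam (fun n => b_pn_bounds p n p1)); exists th => // N.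
by have [n Nn hn] := h N; exists n => //; apply: lt_le_trans hn (a_n_le_b_pn p n p1).
Qed.

(** The constant [(T / 4) ^ (1 / p)] depends only on [th] and [p]; the distortion [D] enters through
    [e] alone. *)
Lemma limsup_b_factors p : 1 < p -> 0 < limn_sup (b_pn Fam p) -> factors Fam.
Proof.
move=> p1 /(limn_sup_gt0P _ lam (fun n => b_pn_bounds p n p1)) [th th0 h].
have p0 : 0 < p by rewrite (lt_trans _ p1).
pose T := th `^ p; have T0 : 0 < T by rewrite powR_gt0.
have T4 : 0 < T / 4 by rewrite divr_gt0.
exists ((T / 4) `^ p^-1); split; first by rewrite powR_gt0.
(* Chosen so that [1 - 3 * e = 1 / D]; then also [1 + 3 * e <= D], and the squared factors of
   [near_isometric_blocks] lie between [1 / D] and [D]. *)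
move=> D D1 M M0; pose e := (D - 1) / (3 * D).
have D0 : 0 < D by rewrite (lt_trans _ D1).
have e0 : 0 < e by rewrite divr_gt0 ?mulr_gt0 // subr_gt0.
have eD : 3 * (e * D) = D - 1 by rewrite /e; field; rewrite gt_eqF.
have e1 : e < 1 by rewrite /e ltr_pdivrMr ?mulr_gt0 //; lra.
have lowD : D^-1 <= (1 - e) ^+ 2.
  by rewrite -[leLHS]mul1r ler_pdivrMr // expr2; nra.
have upD : (1 + e) ^+ 2 <= D by rewrite expr2; nra.
have [N hN] := near_isometric_blocks p lam T e M p1 (ltW lam0) T0 M0 e0 e1.
have [n Nn hn] := h (maxn N 1).
have n0 : (0 < n)%N by rewrite (leq_trans _ Nn) // leq_max orbT.
have {}Nn : (N <= n)%N by rewrite (leq_trans _ Nn) // leq_max leqnn.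
(* As [th] lies below the infimum it is not admissible, so some map and some [f] violate its
   inequality. *)
have [m [Fm [f hf]]] : exists m, Fam m /\ exists f : cube n -> msrc m,
    T * (n%:R * energyk p n (fun e d => mdist (f e) (f d)) 1) <
    energyk p n (fun e d => mdist (mfun m (f e)) (mfun m (f d))) n.
  apply: contrapT => hno; move: hn; apply/negP; rewrite -leNgt.
  apply: ge_inf; first exact: Sb_lb.
  split=> // m Fm f; rewrite b_ineq_energy // leNgt; apply/negP => hlt.
  by apply: hno; exists m; split=> //; exists f.
have [//|g [a [b [a0 b0 ab hg]]]] := hN n Nn _ _ (mdist_pmetric n _ f)
  (mdist_pmetric n _ (fun e => mfun m (f e))) _ hf.
  by move=> ? ?; exact: FamL.
exists m; split=> //; exists (f \o g), a, b; split=> //; split=> //; split.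
  rewrite leNgt; apply/negP => /(gt0_ltr_powR p0).
  rewrite !nnegrE !mulr_ge0 ?powR_ge0 ?(ltW a0) ?(ltW b0) //= => /(_ isT isT).
  rewrite powRM ?powR_ge0 ?(ltW a0) // -powRrM mulVf ?gt_eqF // powRr1 ?(ltW T4) //.
  by rewrite ltNge mulrC ab.
have bound c x y : 0 < c -> 0 <= x ->
    (1 - e) ^+ 2 * (x * c) <= y <= (1 + e) ^+ 2 * (x * c) ->
    c / D * x <= y /\ y <= c * D * x.
  move=> c0 x0 /andP[lo up]; have xc : 0 <= x * c by rewrite mulr_ge0 // ltW.
  split.
    rewrite (_ : c / D * x = D^-1 * (x * c)); last by field; rewrite gt_eqF.
    by apply: le_trans lo; rewrite ler_wpM2r.
  rewrite (_ : c * D * x = D * (x * c)); last by ring.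
  by apply: le_trans up _; rewrite ler_wpM2r.
move=> d d'; have := hg d (cxor d d'); rewrite cxorK hammingE.
have x0 : 0 <= (cwt (cxor d d'))%:R / M%:R :> R by rewrite divr_ge0.
by case=> /(bound _ _ _ a0 x0) [? ?] /(bound _ _ _ b0 x0) [? ?].
Qed.

End Coefficients.

Lemma factors_crudely (R : realType) (Fam : set (metricMap R)) :
  factors Fam -> crudely_factors Fam.
Proof.
move=> [c [c0 h]]; exists c, 2; do 2!split=> //.
by move=> n n0; apply: h => //; rewrite ltr1n.
Qed.
Theorem mainTheorem1 (R : realType) (lam : R) (Fam : set (metricMap R)) :
  0 < lam ->
  (forall m, Fam m -> is_lipschitz_map lam m) ->
  [/\ (factors Fam <-> crudely_factors Fam),
      (crudely_factors Fam <-> 0 < limn_sup (a_n Fam)),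
      (0 < limn_sup (a_n Fam) <->
         forall p : R, 1 < p -> 0 < limn_sup (b_pn Fam p)) &
      ((forall p : R, 1 < p -> 0 < limn_sup (b_pn Fam p)) <->
         exists2 p : R, 1 < p & 0 < limn_sup (b_pn Fam p))].
Proof.
move=> lam0 FamL.
have i_ii := factors_crudely R Fam.
have ii_iii := crude_limsup lam Fam lam0 FamL.
have iii_iv p := limsup_a_b lam Fam lam0 FamL p.
have v_i p := limsup_b_factors lam Fam lam0 FamL p.
have two : 1 < 2 :> R by rewrite ltr1n.
split; split.
- exact: i_ii.
- by move=> /ii_iii /(iii_iv 2 two); exact: v_i.
- exact: ii_iii.
- by move=> /(iii_iv 2 two) /(v_i 2 two); exact: i_ii.
- by move=> h p p1; exact: iii_iv.
- by move=> /(_ 2 two) /(v_i 2 two) /i_ii; exact: ii_iii.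
- by move=> h; exists 2 => //; exact: h.
(* The exponent changes from [p] to [q] by passing through the factorization, which involves no
   exponent. *)
- by move=> [p p1 /(v_i p p1) /i_ii /ii_iii h] q q1; exact: iii_iv.
Qed.
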